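(* Let $P$ be a Dedekind Poisson algebra over an arbitrary field and let $B$ be an associative subalgebra of $P(+,\cdot)$. Then $B$ is a Poisson subalgebra of $P$ and an associative ideal of $P(+,\cdot)$.
   Context: A Poisson algebra over a field $F$ is an $F$-vector space $P$ with a bilinear commutative associative multiplication $xy$ (no identity element is assumed) and an alternating Lie bracket $[\,,\,]$ ($[x,x]=0$ for all $x$) satisfying $[xy,z]=x[y,z]+y[x,z]$. A Poisson subalgebra is a subspace closed under both operations; a Poisson ideal is a subspace $I$ with $PI\subseteq I$ and $[P,I]\subseteq I$. A Poisson algebra is Dedekind if every Poisson subalgebra is a Poisson ideal. $P(+,\cdot)$ denotes $P$ regarded only as a commutative associative algebra; its associative subalgebras are the subspaces $B$ with $BB\subseteq B$ (not required to contain an identity), and its associative ideals are the subspaces $B$ with $PB\subseteq B$. No finite-dimensionality is assumed. *)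

(* Defs.v *)
From HB Require Import structures.
From mathcomp Require Import all_boot all_algebra.
From mathcomp Require Import boolp classical_sets.

Set Implicit Arguments.
Unset Strict Implicit.
Unset Printing Implicit Defensive.

Import GRing.Theory.
Local Open Scope ring_scope.

(* The associative product is not a ring multiplication of MathComp, since the
   MathComp rings have an identity element. *)
HB.mixin Record Lmodule_isPoissonAlgebra (F : fieldType) P
    of GRing.Lmodule F P := {
  pmul : P -> P -> P;
  pbracket : P -> P -> P;
  pmul_bilinear : bilinear_for *:%R *:%R pmul;
  pmulC : commutative pmul;
  pmulA : associative pmul;
  pbracket_bilinear : bilinear_for *:%R *:%R pbracket;
  pbracketxx : forall x, pbracket x x = 0;
  pbracket_jacobi : forall x y z,
    pbracket x (pbracket y z) + pbracket y (pbracket z x)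
      + pbracket z (pbracket x y) = 0;
  pbracket_leibniz : forall x y z,
    pbracket (pmul x y) z = pmul x (pbracket y z) + pmul y (pbracket x z)
}.

#[short(type="poissonAlgType")]
HB.structure Definition PoissonAlgebra (F : fieldType) :=
  { P of GRing.Lmodule F P & Lmodule_isPoissonAlgebra F P }.

Section Subspaces.
Variables (F : fieldType) (P : poissonAlgType F).

(* Subsets are [set P] rather than [{pred P}], so that an arbitrary,
   not necessarily decidable, subspace of P is allowed. *)
Implicit Types B I : set P.

Definition is_subspace B : Prop := submod_closed [in B].

Definition assoc_subalgebra B : Prop :=
  is_subspace B /\ {in B &, forall x y, pmul x y \in B}.

Definition assoc_ideal B : Prop :=
  is_subspace B /\ (forall x y : P, y \in B -> pmul x y \in B).

Definition poisson_subalgebra B : Prop :=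
  [/\ is_subspace B,
      {in B &, forall x y, pmul x y \in B} &
      {in B &, forall x y, pbracket x y \in B}].

Definition poisson_ideal I : Prop :=
  [/\ is_subspace I,
      forall x y : P, y \in I -> pmul x y \in I &
      forall x y : P, y \in I -> pbracket x y \in I].

End Subspaces.

Definition dedekind (F : fieldType) (P : poissonAlgType F) : Prop :=
  forall B : set P, poisson_subalgebra B -> poisson_ideal B.

(* Main.v *)
Require Import Defs.
From mathcomp Require Import all_boot all_algebra.
From mathcomp Require Import classical_sets.

(** Everything reduces to one-generator subalgebras.  By the Leibniz rule the
    centralizer of an element for the bracket is an associative subalgebra;
    applied twice, this shows that the associative subalgebra <x> generated by
    a single element x has zero bracket ([centralizer_subalgebra],
    [gen_bracket0]).  So <x> is a Poisson subalgebra, and in a Dedekind algebra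
    it is a Poisson ideal: both P x and [P, x] lie in <x>.  An associative
    subalgebra B contains <x> for each of its elements x, so it absorbs
    multiplication and bracket by every element of P. *)

Section OneGenerator.
Import GRing.Theory.
Local Open Scope ring_scope.
Local Open Scope classical_set_scope.
Context {F : fieldType} {P : poissonAlgType F}.
Implicit Types (x y z : P) (B : set P).

Lemma pbracket_linearl y (a : F) x z :
  pbracket (a *: x + z) y = a *: pbracket x y + pbracket z y.
Proof. by case: (@pbracket_bilinear F P) => + _; apply. Qed.

Lemma pbracket_linearr y (a : F) x z :
  pbracket y (a *: x + z) = a *: pbracket y x + pbracket y z.
Proof. by case: (@pbracket_bilinear F P) => _; apply. Qed.

Lemma pmul_linearr y (a : F) x z :
  pmul y (a *: x + z) = a *: pmul y x + pmul y z.
Proof. by case: (@pmul_bilinear F P) => _; apply. Qed.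

Lemma pmulx0 y : pmul y 0 = 0.
Proof. by have := pmul_linearr y (-1) 0 0; rewrite !scaleN1r !addNr. Qed.

Lemma pbracket0x y : pbracket 0 y = 0.
Proof. by have := pbracket_linearl y (-1) 0 0; rewrite !scaleN1r !addNr. Qed.

Lemma pbracket_anti x y : pbracket x y = - pbracket y x.
Proof.
apply/eqP; rewrite -addr_eq0; apply/eqP.
have := pbracketxx (1 *: x + y).
by rewrite pbracket_linearl !pbracket_linearr !pbracketxx !scale1r add0r addr0.
Qed.

(** By the Leibniz rule y |-> [y, x] is a derivation, and the kernel of a
    derivation is a subalgebra. *)
Lemma centralizer_subalgebra x :
  assoc_subalgebra [set y : P | pbracket y x = 0].
Proof.
split; first split; rewrite ?in_setE /=.
- exact: pbracket0x.
- move=> a y z; rewrite !in_setE /= => yx zx.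
  by rewrite pbracket_linearl yx zx scaler0 addr0.
- move=> y z; rewrite !in_setE /= => yx zx.
  by rewrite pbracket_leibniz yx zx !pmulx0 addr0.
Qed.

(** The associative subalgebra generated by x, that is, the span of the powers
    x, x^2, x^3, ...; as an intersection it comes with an induction principle,
    and no computation with powers is needed. *)
Definition gen x : set P :=
  [set y | forall B, assoc_subalgebra B -> x \in B -> y \in B].

Lemma mem_gen x : x \in gen x.
Proof. by rewrite in_setE => B. Qed.

Lemma gen_min x B y : assoc_subalgebra B -> x \in B -> y \in gen x -> y \in B.
Proof. by rewrite (in_setE (gen x)) => hB xB; apply. Qed.

Lemma gen_subalgebra x : assoc_subalgebra (gen x).
Proof.
split; first split.
- by rewrite in_setE => B [[B0 _] _] _.
- move=> a y z /= hy hz; rewrite in_setE => B hB xB.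
  case: (hB) => [[_ Blin] _].
  by apply: Blin; apply: (gen_min _ _ _ hB xB).
- move=> y z hy hz; rewrite in_setE => B hB xB.
  case: (hB) => _ Bmul.
  by apply: Bmul; apply: (gen_min _ _ _ hB xB).
Qed.

Lemma gen_bracket0 x y z : y \in gen x -> z \in gen x -> pbracket y z = 0.
Proof.
move=> hy hz.
have yx : pbracket y x = 0.
  have := gen_min _ _ _ (centralizer_subalgebra x) _ hy.
  by rewrite !in_setE /=; apply; apply: pbracketxx.
(* x centralizes y by antisymmetry, hence so does all of <x> *)
have zy : pbracket z y = 0.
  have := gen_min _ _ _ (centralizer_subalgebra y) _ hz.
  by rewrite !in_setE /=; apply; rewrite pbracket_anti yx oppr0.
by rewrite pbracket_anti zy oppr0.
Qed.

Lemma gen_poisson_subalgebra x : poisson_subalgebra (gen x).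
Proof.
have [sub mul] := gen_subalgebra x; split=> // y z hy hz.
by rewrite (gen_bracket0 x y z) //; case: sub.
Qed.

(** The ideal property of <y> already gives the absorption, because <y> is
    contained in B. *)
Lemma dedekind_absorb (hP : dedekind P) B (hB : assoc_subalgebra B) x y :
  y \in B -> pmul x y \in B /\ pbracket x y \in B.
Proof.
move=> yB; have [_ hmul hbr] := hP _ (gen_poisson_subalgebra y).
by split; apply: (gen_min y _ _ hB yB); [apply: hmul | apply: hbr];
  apply: mem_gen.
Qed.

End OneGenerator.

Theorem proposition3p1 (F : fieldType) (P : poissonAlgType F)
    (hP : dedekind P) (B : set P) (hB : assoc_subalgebra B) :
  poisson_subalgebra B /\ assoc_ideal B.
Proof.
have absorb x y := dedekind_absorb hP B hB x y.
case: (hB) => sub mul; split; split=> //.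
- by move=> x y _ /(absorb x) [].
- by move=> x y /(absorb x) [].
Qed.
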